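(* (Propagating IKKT solution $\mathbb{R}^4\times S^3\times S^1$.) Let $N\ge 2$ be an integer and $\xi\in\mathbb{R}$ with $\xi^2=4\sin^2(\pi/N)$. Suppose given the following objects, mutually commuting (every element of one, including adjoints, commutes with every element of the others): a fuzzy cylinder $(U_2,X^2)$ with NC modulus $\xi$ and some radius $R>0$; a fuzzy torus $(U,V)$ with parameter $q=e^{2\pi i/N}$; a fuzzy cylinder $(U_3,X^3)$ with radius $1$ and NC modulus $\xi_3\in\mathbb{R}$; and Hermitian matrices $X^0,X^1$ with $[X^\mu,X^\nu]=i\theta^{\mu\nu}\mathbf 1$ for $\mu,\nu\in\{0,1\}$, where $\theta^{\mu\nu}$ is a real antisymmetric invertible $2\times2$ matrix. Write $U_2=X^4+iX^5$, $U=X^6+iX^7$, $V=X^8+iX^9$ with $X^4,\dots,X^9$ Hermitian, and set $$\tilde Z^1=X^4+iX^6,\qquad \tilde Z^2=X^5+iX^7,\qquad \tilde Z^3=X^8+iX^9 .$$ Let $k_0,k_1\in\mathbb{R}$ and define ten Hermitian matrices ${X^0}',\dots,{X^9}'$ by ${X^a}'=X^a$ for $a=0,1,2,3$ and $${X^4}'+i{X^5}'=\tilde Z^1U_3e^{ik_\mu X^\mu},\qquad {X^6}'+i{X^7}'=\tilde Z^2U_3e^{ik_\mu X^\mu},\qquad {X^8}'+i{X^9}'=\tilde Z^3U_3e^{ik_\mu X^\mu}$$ (sum over $\mu=0,1$). Set $k\cdot k:=\sum_{\mu,\nu,\mu',\nu'\in\{0,1\}}\theta^{\mu\mu'}\theta^{\nu\nu'}\eta_{\mu'\nu'}k_\mu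 k_\nu$. If $k\cdot k=-(\xi^2+\xi_3^2)$, then $$\sum_{b,c=0}^{9}\eta_{bc}[{X^b}',[{X^c}',{X^a}']]=0\qquad\text{for all }a=0,\dots,9,$$ i.e. the matrices ${X^a}'$ solve the IKKT equations of motion.
   Context: Conventions: $\eta=\mathrm{diag}(-1,1,\dots,1)$ on indices $0,\dots,9$; $\mathbf 1$ is the identity. ''Matrices'' are operators on a separable Hilbert space; when they are unbounded, commutators and all identities are understood algebraically on a common invariant dense domain, so everything may be read as taking place in a unital complex $*$-algebra with involution $\dagger$. For a matrix $Z$ written as $Z=A+iB$ with $A,B$ Hermitian, $A=\tfrac12(Z+Z^\dagger)$ and $B=\tfrac1{2i}(Z-Z^\dagger)$. Fuzzy cylinder: a pair $(U,X)$ with $X=X^\dagger$ is a fuzzy cylinder with radius $R>0$ and NC modulus $\xi\in\mathbb{R}$ if $UU^\dagger=U^\dagger U=R^2\mathbf 1$, $[U,X]=\xi U$ and $[U^\dagger,X]=-\xi U^\dagger$. Fuzzy torus: a pair of unitary matrices $(U,V)$ (clock and shift matrices) with $UV=qVU$, i.e. $[U,V]=(q-1)VU$, $q=e^{2\pi i/N}$, and $U^N=V^N=\mathbf 1$. Plane waves: if $[X^\mu,X^\nu]=i\theta^{\mu\nu}\mathbf 1$, then $e^{ik_\mu X^\mu}$ denotes the usual unitary exponential, satisfying $[e^{ik_\mu X^\mu},X^\eta]=-k_\mu\theta^{\mu\eta}e^{ik_\mu X^\mu}$, and commuting with everything that commutes with all the $X^\mu$. *)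

(* Defs.v *)
From HB Require Import structures.
From mathcomp Require Import all_boot all_order all_algebra.
From mathcomp Require Import complex.
From mathcomp Require Import reals trigo.

Set Implicit Arguments.
Unset Strict Implicit.
Unset Printing Implicit Defensive.

Import Order.TTheory GRing.Theory Num.Theory.
Local Open Scope complex_scope.
Local Open Scope ring_scope.

(* Unital *-algebras over C: [dag] is a conjugate-linear involution reversing
   products. For unbounded operators on a common invariant dense domain, [dag]
   is the restriction of the adjoint to that domain. *)
HB.mixin Record isStarAlgebra (C : numClosedFieldType) A of GRing.Algebra C A := {
  dag : A -> A;
  dagK : involutive dag;
  dagD : {morph dag : x y / x + y};
  dagM : forall x y : A, dag (x * y) = dag y * dag x;
  dagZ : forall (c : C) (x : A), dag (c *: x) = Num.conj c *: dag x
}.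

#[short(type="starAlgType")]
HB.structure Definition StarAlgebra (C : numClosedFieldType) :=
  {A of isStarAlgebra C A & GRing.Algebra C A}.

Definition lie (A : pzRingType) (x y : A) : A := x * y - y * x.

Section StarAlgebraNotions.
Context {C : numClosedFieldType} {A : starAlgType C}.
Implicit Types (x y z : A) (s t : seq A).

Definition hermitian x : Prop := dag x = x.

Definition unitary x : Prop := x * dag x = 1 /\ dag x * x = 1.

Definition cartesian z x y : Prop :=
  [/\ hermitian x, hermitian y & z = x + 'i *: y].

Lemma cartesianP z x y :
  cartesian z x y <->
  x = 2^-1 *: (z + dag z) /\ y = (2 * 'i)^-1 *: (z - dag z).
Proof.
have n2 : (2 : C) != 0 by rewrite pnatr_eq0.
have ni : ('i : C) != 0 by rewrite neq0Ci.
have c2 : Num.conj (2^-1 : C) = 2^-1.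
  by apply: CrealP; rewrite realV realn.
have c2i : Num.conj ((2 * 'i)^-1 : C) = - (2 * 'i)^-1.
  by rewrite invfM rmorphM /= c2 -mulrN fmorphV /= conjCi invrN.
have scale2 u : u + u = (2 : C) *: u by rewrite scaler_nat mulr2n.
have dagN u : dag (- u) = - dag u.
  by rewrite -scaleN1r dagZ rmorphN rmorph1 scaleN1r.
split=> [[hx hy ->]|[-> ->]].
  rewrite dagD dagZ hx hy conjCi scaleNr; split.
    by rewrite addrACA subrr addr0 scale2 scalerA mulVf // scale1r.
  rewrite opprD opprK addrACA subrr add0r scale2 !scalerA.
  by rewrite mulVf ?scale1r // mulf_neq0.
split.
- by rewrite /hermitian dagZ dagD dagK c2 addrC.
- rewrite /hermitian dagZ dagD dagN dagK c2i.
  by rewrite scaleNr -scalerN opprB.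
rewrite scalerA invfM mulrCA divff // mulr1 -scalerDr addrACA subrr addr0.
by rewrite scale2 scalerA mulVf // scale1r.
Qed.

Definition commuting_families s t : Prop :=
  forall x y, x \in s ++ map dag s -> y \in t ++ map dag t -> x * y = y * x.

Definition mutually_commuting (fs : seq (seq A)) : Prop :=
  forall i j : nat, (i < j < size fs)%N ->
    commuting_families (nth [::] fs i) (nth [::] fs j).

End StarAlgebraNotions.

Definition minkowski (K : pzRingType) (n : nat) : 'M[K]_n :=
  diag_mx (\row_(i < n) (if (i : nat) == 0%N then -1 else 1)).

(* the indices 0 and 1 among 0, ..., 9 *)
Definition lo (m : 'I_2) : 'I_10 := widen_ord (isT : (2 <= 10)%N) m.

Section FuzzyGeometries.
Context {R : realType} {A : starAlgType R[i]}.

Definition expi (t : R) : R[i] := cos t +i* sin t.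

Definition fuzzy_cylinder (U X : A) (r xi : R) : Prop :=
  [/\ hermitian X,
      0 < r,
      U * dag U = (r ^+ 2)%:C *: 1 /\ dag U * U = (r ^+ 2)%:C *: 1,
      lie U X = xi%:C *: U
    & lie (dag U) X = - (xi%:C *: dag U)].

Definition fuzzy_torus (U V : A) (N : nat) : Prop :=
  [/\ unitary U, unitary V,
      U * V = expi (2 * pi / N%:R) *: (V * U),
      U ^+ N = 1
    & V ^+ N = 1].

Definition noncommutative_plane (x : 'I_2 -> A) (theta : 'M[R]_2) : Prop :=
  [/\ forall m, hermitian (x m),
      theta^T = - theta,
      theta \in unitmx
    & forall m n, lie (x m) (x n) = ('i * (theta m n)%:C) *: 1].

(* [W] is the plane wave exp(i k_m x^m). A *-algebra carries no functional
   calculus, so the exponential enters through its defining relations. *)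
Definition plane_wave (x : 'I_2 -> A) (theta : 'M[R]_2) (k : 'I_2 -> R)
    (W : A) : Prop :=
  [/\ unitary W,
      forall n, lie W (x n) = - ((\sum_(m < 2) k m * theta m n)%:C *: W)
    & forall y, (forall m, x m * y = y * x m) -> W * y = y * W].

Definition kdotk (theta : 'M[R]_2) (k : 'I_2 -> R) : R :=
  \sum_(m < 2) \sum_(n < 2) \sum_(m' < 2) \sum_(n' < 2)
    theta m m' * theta n n' * minkowski R 10 (lo m') (lo n') * k m * k n.

Definition ikkt_solution (X : 'I_10 -> A) : Prop :=
  forall a : 'I_10,
    \sum_(b < 10) \sum_(c < 10)
      minkowski R[i] 10 b c *: lie (X b) (lie (X c) (X a)) = 0.

End FuzzyGeometries.

(* Main.v *)
Require Import Defs.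
From mathcomp Require Import all_boot all_order all_algebra.
From mathcomp Require Import complex.
From mathcomp Require Import reals trigo.
From mathcomp Require Import ring.

Set Implicit Arguments.
Unset Strict Implicit.
Unset Printing Implicit Defensive.

Import Order.TTheory GRing.Theory Num.Theory.
Local Open Scope complex_scope.
Local Open Scope ring_scope.

(** Write P = U3 W. It is unitary and commutes with X2 and X4, ..., X9, so it
    cancels from [Z'_j, [Z'_j^dag, w]] whenever w commutes with P; since
    [Z, [Z^dag, -]] + [Z^dag, [Z, -]] is twice the sum of the double commutators
    with the Hermitian parts of Z, regrouping X4, ..., X9 into the pairs of the
    Z~_j costs nothing. On each of X4, ..., X9 the double commutators with
    X2, X4, ..., X9 then add up to xi^2: for X4, X5 this comes from X2 (cylinder),
    for X6, ..., X9 from the torus, where it is 2 - q - q^* = 4 sin^2(pi / N).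
    The remaining X0, X1, X3 act on P alone and contribute k.k + xi3^2.
    For a = 0, 1, 3 the matrix X_a acts on each Z'_j by a real scalar, and the
    two double commutators cancel because Z'_j is normal; the same argument
    applied to U2 handles a = 2. *)

(** * Commutator calculus in a unital star-algebra *)

Section Lie.
Context {C : numClosedFieldType} {A : starAlgType C}.
Implicit Types (x y z w : A) (c : C).

Lemma commrZ x y c : GRing.comm x y -> GRing.comm x (c *: y).
Proof. by move=> xy; rewrite /GRing.comm -scalerAl -scalerAr xy. Qed.

Lemma lieC x y : lie x y = - lie y x.
Proof. by rewrite /lie opprB. Qed.

Lemma lie_comm x y : GRing.comm x y -> lie x y = 0.
Proof. by move=> xy; rewrite /lie xy subrr. Qed.

Lemma lieDl x y z : lie (x + y) z = lie x z + lie y z.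
Proof. by rewrite /lie mulrDl mulrDr opprD addrACA. Qed.

Lemma lieDr x y z : lie x (y + z) = lie x y + lie x z.
Proof. by rewrite /lie mulrDl mulrDr opprD addrACA. Qed.

Lemma lieZl c x y : lie (c *: x) y = c *: lie x y.
Proof. by rewrite /lie -scalerAl -scalerAr scalerBr. Qed.

Lemma lieZr c x y : lie x (c *: y) = c *: lie x y.
Proof. by rewrite /lie -scalerAl -scalerAr scalerBr. Qed.

Lemma lieMr x y z : lie x (y * z) = lie x y * z + y * lie x z.
Proof. by rewrite /lie mulrBl mulrBr !mulrA addrA subrK. Qed.

Lemma lieMl_comm x y z : GRing.comm y z -> lie (x * y) z = lie x z * y.
Proof. by move=> yz; rewrite /lie mulrBl -!mulrA yz. Qed.

Lemma dag_lie x y : dag (lie x y) = - lie (dag x) (dag y).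
Proof.
have dagN u : dag (- u) = - dag u.
  by rewrite -scaleN1r dagZ rmorphN rmorph1 scaleN1r.
by rewrite /lie dagD dagN !dagM opprB.
Qed.

Lemma comm_dag x y : GRing.comm x y -> GRing.comm (dag x) (dag y).
Proof. by move=> xy; rewrite /GRing.comm -!dagM xy. Qed.


(** * Double commutators *)

Definition dlie x w : A := lie x (lie x w).

Lemma dlieD x : {morph dlie x : v w / v + w}.
Proof. by move=> v w; rewrite /dlie !lieDr. Qed.

Lemma dlieZ x c w : dlie x (c *: w) = c *: dlie x w.
Proof. by rewrite /dlie !lieZr. Qed.

Lemma dlie_comm x w : GRing.comm x w -> dlie x w = 0.
Proof.
by move=> xw; rewrite /dlie (lie_comm xw) /lie mulr0 mul0r subrr.
Qed.

Lemma dlie_eigen x w c : lie x w = c *: w -> dlie x w = c ^+ 2 *: w.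
Proof. by move=> h; rewrite /dlie h lieZr h scalerA expr2. Qed.

Lemma dlie_scalar x w c : lie x w = c *: 1 -> dlie x w = 0.
Proof.
move=> h; rewrite /dlie h lieZr lie_comm ?scaler0 //.
exact: commr1.
Qed.

Lemma dlieMl x v w : GRing.comm x w -> dlie x (v * w) = dlie x v * w.
Proof.
by move=> xw; rewrite /dlie !(lieMr, lie_comm xw, mulr0, addr0).
Qed.

Lemma dlieMr x v w : GRing.comm x v -> dlie x (v * w) = v * dlie x w.
Proof.
by move=> xv; rewrite /dlie !(lieMr, lie_comm xv, mul0r, add0r).
Qed.

Lemma dag_dlie x w : dag x = x -> dag (dlie x w) = dlie x (dag w).
Proof. by move=> hx; rewrite /dlie !dag_lie hx /lie mulrN mulNr opprB opprK addrC. Qed.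

(** * Hermitian parts of a matrix *)

Section Cartesian.
Variables (z x y : A).
Hypothesis zxy : cartesian z x y.

Lemma cartesian_dag : dag z = x - 'i *: y.
Proof. by case: zxy => hx hy ->; rewrite dagD dagZ hx hy conjCi scaleNr. Qed.

Lemma comm_cartesian w : GRing.comm w z -> GRing.comm w (dag z) ->
  GRing.comm w x /\ GRing.comm w y.
Proof.
have [-> ->] := (iffLR (cartesianP _ _ _) zxy).
move=> wz wz'; split; apply: commrZ; first exact: commrD.
exact: commrB.
Qed.

Lemma cartesian_comm w : GRing.comm w x -> GRing.comm w y -> GRing.comm w z.
Proof.
by case: zxy => _ _ -> wx wy; apply: commrD => //; apply: commrZ.
Qed.

(** The commutator of [z] with [dag z] is -2i times [lie x y]. *)
Lemma cartesian_normal : z * dag z = dag z * z <-> GRing.comm x y.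
Proof.
have zz : lie z (dag z) = - (2 * 'i) *: lie x y.
  rewrite cartesian_dag; case: zxy => _ _ ->.
  rewrite -scaleNr lieDl !lieDr !lieZl !lieZr !(lie_comm (commr_refl _)).
  rewrite !scaler0 add0r addr0 (lieC y x) scalerN -scaleNr -scalerDl.
  by congr (_ *: _); ring.
split=> h; last first.
  by apply/eqP; rewrite -subr_eq0 -/(lie z _) zz lie_comm ?scaler0.
apply/eqP; rewrite -subr_eq0 -/(lie x y); move/eqP: zz.
rewrite lie_comm // eq_sym scaler_eq0 oppr_eq0 mulf_eq0.
by rewrite pnatr_eq0 (negbTE (neq0Ci _)).
Qed.

(** The mixed terms [lie x (lie y w)] and [lie y (lie x w)] enter the two orderings of [z] and
    [dag z] with opposite signs, so the symmetrised sum removes them whether or not [x] and [y]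
    commute. *)
Lemma dlie_cartesian w :
  dlie x w + dlie y w =
  2^-1 *: (lie z (lie (dag z) w) + lie (dag z) (lie z w)).
Proof.
rewrite cartesian_dag; case: zxy => _ _ ->.
have lie_lin c d u v : lie (x + c *: y) (u + d *: v) =
    lie x u + d *: lie x v + (c *: lie y u + (c * d) *: lie y v).
  by rewrite lieDl lieZl 2!lieDr 2!lieZr (scalerDr c) scalerA.
rewrite -scaleNr !(lieDl _ _ w) !lieZl !lie_lin -/(dlie x w) -/(dlie y w).
move: (dlie x w) (dlie y w) (lie x (lie y w)) (lie y (lie x w)) => a b u v.
rewrite mulrN mulNr -expr2 sqrCi opprK scale1r !scaleNr.
rewrite addrACA (addrACA a) addNr addr0 (addrACA _ b) subrr add0r.
rewrite -!mulr2n -mulrnDl -scaler_nat scalerA mulVf ?pnatr_eq0 //.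
by rewrite scale1r.
Qed.

(* The relation [w, z] = c z with c real rotates the pair (x, y), so
   the two double commutators add up to a multiple of [x, y]. *)
Lemma dlie_cartesian_eigen w c : dag w = w -> Num.conj c = c ->
  GRing.comm x y -> lie w z = c *: z -> dlie x w + dlie y w = 0.
Proof.
move=> hw hc xy wz.
have wz' : lie w (dag z) = - (c *: dag z).
  have := congr1 dag wz; rewrite dag_lie hw dagZ hc => /eqP.
  by rewrite eqr_oppLR => /eqP.
have nz : lie z (dag z) = 0 by apply: lie_comm; apply/cartesian_normal.
have nz' : lie (dag z) z = 0 by rewrite lieC nz oppr0.
rewrite dlie_cartesian (lieC (dag z) w) (lieC z w) wz' wz opprK.
by rewrite -scaleNr !lieZr nz nz' !scaler0 addr0 scaler0.
Qed.

End Cartesian.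

(** * Multiplication by a commuting unitary *)

Lemma unitary_comm_dag p w : unitary p -> GRing.comm p w -> GRing.comm (dag p) w.
Proof.
case=> pp' p'p pw; rewrite /GRing.comm.
by rewrite -[RHS]mul1r -p'p -!mulrA (mulrA p w) pw -mulrA pp' mulr1.
Qed.

Lemma unitaryM p u : unitary p -> unitary u -> unitary (p * u : A).
Proof.
case=> pp' p'p [uu' u'u]; split; rewrite dagM.
  by rewrite mulrA -(mulrA p) uu' mulr1.
by rewrite mulrA -(mulrA _ _ p) p'p mulr1.
Qed.

(** The factor [p] cancels in both products, leaving [t * dag t] and [dag t * t]. This carries
    normality over to the twisted matrices of the solution. *)
Lemma unitary_normalM p t : GRing.comm p t -> unitary p ->
  GRing.comm t (dag t) -> GRing.comm (t * p) (dag (t * p : A)).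
Proof.
move=> pt [pp' p'p] nt.
have p't' : dag p * dag t = dag t * dag p by rewrite -!dagM pt.
rewrite /GRing.comm dagM -[LHS]mulrA (mulrA p) pp' mul1r nt p't' -pt.
by rewrite -[RHS]mulrA (mulrA (dag p)) p'p mul1r.
Qed.

(** As [dag p] commutes with [w], it leaves the inner commutator as a right factor; in each term of
    the outer commutator it then meets [p] and cancels. *)
Lemma lie_twist p t s w : unitary p -> GRing.comm p t -> GRing.comm p s ->
  GRing.comm p w -> lie (t * p) (lie (s * dag p) w) = lie t (lie s w).
Proof.
move=> up pt ps pw; have [pp' p'p] := up.
have p't := unitary_comm_dag up pt.
have pm : GRing.comm p (lie s w) by apply: commrB; apply: commrM.
rewrite (lieMl_comm s); last exact: unitary_comm_dag.
rewrite {1}/lie -!mulrA (mulrA p) pm -!mulrA pp' mulr1.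
by rewrite [dag p * _]mulrA p't -mulrA p'p mulr1.
Qed.

Lemma lie_twistV p t s w : unitary p -> GRing.comm p t -> GRing.comm p s ->
  GRing.comm p w -> lie (s * dag p) (lie (t * p) w) = lie s (lie t w).
Proof.
move=> up pt ps pw; have up' : unitary (dag p) by case: up => pp' p'p; split; rewrite dagK.
by rewrite -{2}(dagK p) lie_twist //; apply: unitary_comm_dag.
Qed.

(** Through [dlie_cartesian] both sides depend only on [z] and [t], where [p] cancels against its
    adjoint. Only the sum is invariant: already p = i exchanges the two terms. *)
Lemma dlie_twist p t a b z x y w : cartesian t a b -> cartesian z x y ->
  z = t * p -> unitary p -> GRing.comm p a -> GRing.comm p b ->
  GRing.comm p w -> dlie x w + dlie y w = dlie a w + dlie b w.
Proof.
move=> tab zxy ztp up pa pb pw.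
have pt := cartesian_comm tab pa pb.
have pt' : GRing.comm p (dag t).
  by rewrite -(dagK p); apply: comm_dag; apply: unitary_comm_dag.
have zt' : dag z = dag t * dag p.
  by rewrite ztp dagM; apply: unitary_comm_dag.
by rewrite (dlie_cartesian zxy) (dlie_cartesian tab) zt' ztp
  lie_twist ?lie_twistV.
Qed.

(** Commuting with [dag u] and with [u] gives the factors 1 - q and 1 - q^*, in either order, while
    the powers of [u] cancel. As |q| = 1, their product is 2 - q - q^*. *)
Lemma dlie_clock_shift q u v x y : unitary u -> cartesian u x y ->
  q * Num.conj q = 1 -> u * v = q *: (v * u) ->
  dlie x v + dlie y v = (2 - q - Num.conj q) *: v.
Proof.
move=> [uu' u'u] uxy qq' uv; rewrite (dlie_cartesian uxy).
set q' := Num.conj q in qq' *.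
have vu : v * u = q' *: (u * v) by rewrite uv scalerA mulrC qq' scale1r.
have vu' : v * dag u = q *: (dag u * v).
  by rewrite -[LHS]mul1r -u'u -!mulrA (mulrA u) uv -scalerAl -scalerAr -mulrA uu' mulr1.
have -> : lie (dag u) v = (1 - q) *: (dag u * v).
  by rewrite /lie vu' scalerBl scale1r.
have -> : lie u v = (1 - q') *: (u * v).
  by rewrite /lie vu scalerBl scale1r.
rewrite !lieZr.
have -> : lie u (dag u * v) = (1 - q') *: v.
  rewrite /lie mulrA uu' mul1r -mulrA vu -scalerAr mulrA u'u mul1r.
  by rewrite scalerBl scale1r.
have -> : lie (dag u) (u * v) = (1 - q) *: v.
  rewrite /lie mulrA u'u mul1r -mulrA vu' -scalerAr mulrA uu' mul1r.
  by rewrite scalerBl scale1r.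
rewrite !scalerA -scalerDl scalerA; congr (_ *: _).
have -> : 2 - q - q' = (1 - q) * (1 - q').
  by rewrite mulrBl mul1r mulrBr mulr1 qq'; ring.
by field.
Qed.

(** A linear map that respects [dag] has [dag z] as an eigenvector for the same real eigenvalue.
    This serves for the inner double commutators and, with eigenvalue 0, for [box]. *)
Lemma cartesian_eigen (f : A -> A) c z x y :
  {morph f : v w / v + w} -> (forall d w, f (d *: w) = d *: f w) ->
  (forall w, dag (f w) = f (dag w)) ->
  Num.conj c = c -> cartesian z x y -> f z = c *: z -> f x = c *: x /\ f y = c *: y.
Proof.
move=> fD fZ fdag hc zxy fz.
have fz' : f (dag z) = c *: dag z by rewrite -fdag fz dagZ hc.
have [-> ->] := (iffLR (cartesianP _ _ _) zxy).
rewrite -[- dag z]scaleN1r !(fZ, fD) fz fz' !scalerA.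
by split; rewrite !scalerDr !scalerA; congr (_ *: _ + _ *: _); ring.
Qed.

(** Holds by conversion: on literal lists, appending the adjoints reduces to these four-element
    lists. *)
Lemma comm_of_families (a b c d : A) :
  commuting_families [:: a; b] [:: c; d] ->
  forall u v, u \in [:: a; b; dag a; dag b] -> v \in [:: c; d; dag c; dag d] ->
  GRing.comm u v.
Proof. by []. Qed.

(** * The ten indices and the matrix d'Alembertian *)

Lemma ord10_ind (Q : 'I_10 -> Prop) :
  Q (inord 0) -> Q (inord 1) -> Q (inord 2) -> Q (inord 3) -> Q (inord 4) ->
  Q (inord 5) -> Q (inord 6) -> Q (inord 7) -> Q (inord 8) -> Q (inord 9) ->
  forall a, Q a.
Proof.
move=> ? ? ? ? ? ? ? ? ? ? a; rewrite -(inord_val a).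
by case: a; do 10?[case=> //].
Qed.

(** The d'Alembertian of the background [X]. The brackets keep together the pairs that [dlie_twist]
    rewrites. *)
Definition box (X : 'I_10 -> A) w : A :=
  let d m := dlie (X (inord m)) w in
  - d 0%N + d 1%N + (d 2%N + d 3%N)
  + ((d 4%N + d 5%N) + (d 6%N + d 7%N) + (d 8%N + d 9%N)).

Lemma ikkt_sumE (X : 'I_10 -> A) w :
  \sum_(b < 10) \sum_(c < 10)
    minkowski C 10 b c *: lie (X b) (lie (X c) w) = box X w.
Proof.
pose g m := (if m == 0%N then -1 else 1) *: dlie (X (inord m)) w.
have diag (b : 'I_10) (_ : true) :
    \sum_(c < 10) minkowski C 10 b c *: lie (X b) (lie (X c) w) = g b.
  rewrite (bigD1 b) //= big1 => [|c cb]; last first.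
    by rewrite !mxE (eq_sym b c) (negbTE cb) mulr0n scale0r.
  by rewrite !mxE eqxx mulr1n addr0 /g inord_val.
rewrite (eq_bigr _ diag) -(big_mkord xpredT g) unlock /= /g /= !scale1r scaleN1r.
by rewrite addr0 /box !addrA.
Qed.

Lemma boxD X : {morph box X : v w / v + w}.
Proof.
move=> v w; rewrite /box /= !dlieD opprD.
by do ?[by [] | rewrite [RHS]addrACA; congr (_ + _)].
Qed.

Lemma boxZ X c w : box X (c *: w) = c *: box X w.
Proof. by rewrite /box /= !dlieZ -scalerN -!scalerDr. Qed.

Lemma dag_box X w : (forall a, dag (X a) = X a) -> dag (box X w) = box X (dag w).
Proof.
move=> hX; have dagN (u : A) : dag (- u) = - dag u.
  by rewrite -scaleN1r dagZ rmorphN rmorph1 scaleN1r.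
have dd m : dag (dlie (X (inord m)) w) = dlie (X (inord m)) (dag w).
  exact: dag_dlie.
by rewrite /box /= !(dd, dagN, dagD).
Qed.

End Lie.

(** * Phases and the contraction k.k *)

Section Trig.
Context {R : realType}.

Lemma conj_expi (t : R) : Num.conj (expi t) = expi (- t).
Proof. by rewrite /expi cosN sinN. Qed.

Lemma expi_mul_conj (t : R) : expi t * Num.conj (expi t) = 1.
Proof.
apply/eqP; rewrite conj_expi /expi cosN sinN eq_complex /=.
by rewrite mulrN opprK -!expr2 cos2Dsin2 mulrN mulrC addrC subrr !eqxx.
Qed.

(** The real part is 2 - 2 cos 2t. With t = pi / N the phase is q. *)
Lemma two_sub_expi (t : R) :
  2 - expi (t + t) - Num.conj (expi (t + t)) = (4 * sin t ^+ 2)%:C.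
Proof.
apply/eqP; rewrite conj_expi /expi cosN sinN eq_complex /=.
rewrite cosD -[cos t * cos t]expr2 cos2sin2; apply/andP; split; apply/eqP; ring.
Qed.

Lemma conjC_real (c : R) : Num.conj (c%:C : R[i]) = c%:C.
Proof. by apply/eqP; rewrite eq_complex /= oppr0 !eqxx. Qed.

(** The metric forces m' = n', and for each value the sums over m and n factor into the square of
    one linear form in [k]. *)
Lemma kdotkE (theta : 'M[R]_2) (k : 'I_2 -> R) :
  kdotk theta k = - (\sum_(m < 2) k m * theta m 0) ^+ 2
                  + (\sum_(m < 2) k m * theta m 1) ^+ 2.
Proof.
rewrite /kdotk !big_ord_recl !big_ord0 !mxE /=.
have -> : lift ord0 ord0 = 1 :> 'I_2 by apply: val_inj.
ring.
Qed.

End Trig.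

Theorem mainTheorem3 (R : realType) (A : starAlgType R[i])
    (N : nat) (xi xi3 r : R)
    (U2 U V U3 W : A) (X X' : 'I_10 -> A)
    (theta : 'M[R]_2) (k : 'I_2 -> R)
    (hN : (2 <= N)%N)
    (hxi : xi ^+ 2 = 4 * sin (pi / N%:R) ^+ 2)
    (hU2 : fuzzy_cylinder U2 (X (inord 2)) r xi)
    (hUV : fuzzy_torus U V N)
    (hU3 : fuzzy_cylinder U3 (X (inord 3)) 1 xi3)
    (hX01 : noncommutative_plane (fun m : 'I_2 => X (lo m)) theta)
    (hcomm : mutually_commuting
       [:: [:: U2; X (inord 2)]; [:: U; V]; [:: U3; X (inord 3)];
           [:: X (inord 0); X (inord 1)]])
    (hX45 : cartesian U2 (X (inord 4)) (X (inord 5)))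
    (hX67 : cartesian U (X (inord 6)) (X (inord 7)))
    (hX89 : cartesian V (X (inord 8)) (X (inord 9)))
    (hW : plane_wave (fun m : 'I_2 => X (lo m)) theta k W)
    (hX'03 : forall a : 'I_10, (a < 4)%N -> X' a = X a)
    (hX'45 : cartesian ((X (inord 4) + 'i *: X (inord 6)) * U3 * W)
               (X' (inord 4)) (X' (inord 5)))
    (hX'67 : cartesian ((X (inord 5) + 'i *: X (inord 7)) * U3 * W)
               (X' (inord 6)) (X' (inord 7)))
    (hX'89 : cartesian ((X (inord 8) + 'i *: X (inord 9)) * U3 * W)
               (X' (inord 8)) (X' (inord 9)))
    (hkk : kdotk theta k = - (xi ^+ 2 + xi3 ^+ 2)) :
  ikkt_solution X'.
Proof.
have lo0 : lo 0 = inord 0 by apply: val_inj; rewrite /= inordK.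
have lo1 : lo 1 = inord 1 by apply: val_inj; rewrite /= inordK.
have x'0 : X' (inord 0) = X (inord 0) by apply: hX'03; rewrite inordK.
have x'1 : X' (inord 1) = X (inord 1) by apply: hX'03; rewrite inordK.
have x'2 : X' (inord 2) = X (inord 2) by apply: hX'03; rewrite inordK.
have x'3 : X' (inord 3) = X (inord 3) by apply: hX'03; rewrite inordK.
have [hx2 _ [UU2 UU2'] U2x2 _] := hU2.
have [hx3 _ [UU3 UU3'] U3x3 _] := hU3.
have [uU uV UV _ _] := hUV.
have [hx01 _ _ x01] := hX01.
have [uW Wx Wc] := hW.
have [hx4 hx5 _] := hX45; have [hx6 hx7 _] := hX67; have [hx8 hx9 _] := hX89.
have hx0 : dag (X (inord 0)) = X (inord 0) by have := hx01 0; rewrite lo0.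
have hx1 : dag (X (inord 1)) = X (inord 1) by have := hx01 1; rewrite lo1.
have hX' : forall a, dag (X' a) = X' a.
  case: hX'45 hX'67 hX'89 => ? ? _ [? ? _] [? ? _].
  by apply: ord10_ind; rewrite ?x'0 ?x'1 ?x'2 ?x'3.
(* Commutation with X^0 and X^1 multiplies the plane wave by these real numbers; [kk] is the
   dispersion relation in terms of them. *)
pose c0 : R := \sum_(m < 2) k m * theta m 0.
pose c1 : R := \sum_(m < 2) k m * theta m 1.
have kk : - c0 ^+ 2 + c1 ^+ 2 + xi3 ^+ 2 + xi ^+ 2 = 0.
  by rewrite -kdotkE hkk; ring.
have x0W : lie (X (inord 0)) W = c0%:C *: W.
  by rewrite lieC -lo0 Wx opprK.
have x1W : lie (X (inord 1)) W = c1%:C *: W.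
  by rewrite lieC -lo1 Wx opprK.
have {Wc}Wcomm y : GRing.comm (X (inord 0)) y -> GRing.comm (X (inord 1)) y ->
    GRing.comm W y.
  move=> x0y x1y; apply: Wc => m; case: m => [[|[|//]] lt2] /=.
    by rewrite (_ : Ordinal lt2 = 0) ?lo0 //; apply: val_inj.
  by rewrite (_ : Ordinal lt2 = 1) ?lo1 //; apply: val_inj.
have c01 := comm_of_families (hcomm 0%N 1%N isT).
have c02 := comm_of_families (hcomm 0%N 2%N isT).
have c03 := comm_of_families (hcomm 0%N 3%N isT).
have c12 := comm_of_families (hcomm 1%N 2%N isT).
have c13 := comm_of_families (hcomm 1%N 3%N isT).
have c23 := comm_of_families (hcomm 2%N 3%N isT).
rewrite /= in c01 c02 c03 c12 c13 c23.
set x0 := X (inord 0) in c03 c13 c23 hx0 x0W Wcomm x'0 *.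
set x1 := X (inord 1) in c03 c13 c23 hx1 x1W Wcomm x'1 *.
set x2 := X (inord 2) in c01 c02 c03 hx2 U2x2 x'2 *.
set x3 := X (inord 3) in c02 c12 c23 hx3 U3x3 x'3 *.
set x4 := X (inord 4) in hX45 hx4 hX'45 *.
set x5 := X (inord 5) in hX45 hx5 hX'67 *.
set x6 := X (inord 6) in hX67 hx6 hX'45 *.
set x7 := X (inord 7) in hX67 hx7 hX'67 *.
set x8 := X (inord 8) in hX89 hx8 hX'89 *.
set x9 := X (inord 9) in hX89 hx9 hX'89 *.
have mem4 (a b c d : A) : [/\ a \in [:: a; b; c; d], b \in [:: a; b; c; d],
    c \in [:: a; b; c; d] & d \in [:: a; b; c; d]].
  by rewrite !inE !eqxx !orbT.
(* The commuting families contain U2, U, V and their adjoints; commutation has to be passed on to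
   the Hermitian parts. *)
have parts (z a b w : A) : cartesian z a b -> GRing.comm z w -> GRing.comm (dag z) w ->
    GRing.comm a w /\ GRing.comm b w.
  move=> zab zw z'w.
  have [wa wb] := comm_cartesian zab (commr_sym zw) (commr_sym z'w).
  by split; apply: commr_sym.
have in45 w : (forall u, u \in [:: U2; x2; dag U2; dag x2] -> GRing.comm u w) ->
    [/\ GRing.comm x2 w, GRing.comm x4 w & GRing.comm x5 w].
  have [m1 m2 m3 _] := mem4 U2 x2 (dag U2) (dag x2).
  by move=> h; have [] := parts _ _ _ w hX45 (h _ m1) (h _ m3); split; auto.
have in69 w : (forall u, u \in [:: U; V; dag U; dag V] -> GRing.comm u w) ->
    [/\ GRing.comm x6 w, GRing.comm x7 w, GRing.comm x8 w & GRing.comm x9 w].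
  have [m1 m2 m3 m4] := mem4 U V (dag U) (dag V).
  move=> h; have [] := parts _ _ _ w hX67 (h _ m1) (h _ m3).
  by have [] := parts _ _ _ w hX89 (h _ m2) (h _ m4); split; auto.
have [mU3 mx3 _ _] := mem4 U3 x3 (dag U3) (dag x3).
have [mx0 mx1 _ _] := mem4 x0 x1 (dag x0) (dag x1).
(* From here on a name such as [x20] records that [x2] commutes with [x0]. *)
have [x20 x40 x50] := in45 x0 (fun u hu => c03 u x0 hu mx0).
have [x21 x41 x51] := in45 x1 (fun u hu => c03 u x1 hu mx1).
have [x23 x43 x53] := in45 x3 (fun u hu => c02 u x3 hu mx3).
have [x2U3 x4U3 x5U3] := in45 U3 (fun u hu => c02 u U3 hu mU3).
have [x60 x70 x80 x90] := in69 x0 (fun u hu => c13 u x0 hu mx0).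
have [x61 x71 x81 x91] := in69 x1 (fun u hu => c13 u x1 hu mx1).
have [x63 x73 x83 x93] := in69 x3 (fun u hu => c12 u x3 hu mx3).
have [x6U3 x7U3 x8U3 x9U3] := in69 U3 (fun u hu => c12 u U3 hu mU3).
have x30 := c23 x3 x0 mx3 mx0; have x31 := c23 x3 x1 mx3 mx1.
have U30 := c23 U3 x0 mU3 mx0; have U31 := c23 U3 x1 mU3 mx1.
have to69 w : w \in [:: U2; x2; dag U2; dag x2] ->
    [/\ GRing.comm x6 w, GRing.comm x7 w, GRing.comm x8 w & GRing.comm x9 w].
  by move=> hw; apply: in69 => v hv; apply: commr_sym; apply: c01.
have [mU2 mx2 mU2' _] := mem4 U2 x2 (dag U2) (dag x2).
have [x62 x72 x82 x92] := to69 _ mx2.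
have [x6U2 x7U2 x8U2 x9U2] := to69 _ mU2.
have [x6U2' x7U2' x8U2' x9U2'] := to69 _ mU2'.
have [x64 x65] := comm_cartesian hX45 x6U2 x6U2'.
have [x74 x75] := comm_cartesian hX45 x7U2 x7U2'.
have [x84 x85] := comm_cartesian hX45 x8U2 x8U2'.
have [x94 x95] := comm_cartesian hX45 x9U2 x9U2'.
have x45 : GRing.comm x4 x5 by apply/(cartesian_normal hX45); rewrite UU2 UU2'.
have x67 : GRing.comm x6 x7.
  by apply/(cartesian_normal hX67); case: uU => -> ->.
have x89 : GRing.comm x8 x9.
  by apply/(cartesian_normal hX89); case: uV => -> ->.
have uU3 : unitary U3 by split; rewrite ?UU3 ?UU3' expr1n scale1r.
pose P : A := U3 * W.
have uP : unitary P by apply: unitaryM.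
(* The plane wave commutes with whatever commutes with [x0] and [x1]. *)
have PC s : GRing.comm s U3 -> GRing.comm s x0 -> GRing.comm s x1 -> GRing.comm P s.
  move=> sU s0 s1; apply: commr_sym; apply: commrM => //.
  by apply: commr_sym; apply: Wcomm; apply: commr_sym.
have P2 : GRing.comm P x2 by apply: PC.
have P4 : GRing.comm P x4 by apply: PC.
have P5 : GRing.comm P x5 by apply: PC.
have P6 : GRing.comm P x6 by apply: PC.
have P7 : GRing.comm P x7 by apply: PC.
have P8 : GRing.comm P x8 by apply: PC.
have P9 : GRing.comm P x9 by apply: PC.
have x0P : lie x0 P = c0%:C *: P.
  by rewrite lieMr x0W (lie_comm (commr_sym U30)) mul0r add0r -scalerAr.
have x1P : lie x1 P = c1%:C *: P.
  by rewrite lieMr x1W (lie_comm (commr_sym U31)) mul0r add0r -scalerAr.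
have x3P : lie x3 P = - xi3%:C *: P.
  have W3 : GRing.comm W x3 by apply: Wcomm; apply: commr_sym.
  rewrite lieMr (lieC x3 U3) U3x3 (lie_comm (commr_sym W3)) mulr0 addr0.
  by rewrite mulNr -scalerAl scaleNr.
(* Any two Hermitian matrices form a Cartesian pair, so cylinder and torus components may be
   mixed. *)
have hZ1 : cartesian (x4 + 'i *: x6) x4 x6 by [].
have hZ2 : cartesian (x5 + 'i *: x7) x5 x7 by [].
have hZ3 : cartesian (x8 + 'i *: x9) x8 x9 by [].
rewrite -!mulrA -/P in hX'45 hX'67 hX'89.
have boxE w : GRing.comm P w -> box X' w =
    - dlie x0 w + dlie x1 w + (dlie x2 w + dlie x3 w)
    + (dlie x4 w + dlie x6 w + (dlie x5 w + dlie x7 w) + (dlie x8 w + dlie x9 w)).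
  move=> Pw; rewrite /box x'0 x'1 x'2 x'3.
  by rewrite (dlie_twist hZ1 hX'45 erefl) ?(dlie_twist hZ2 hX'67 erefl)
    ?(dlie_twist hZ3 hX'89 erefl).
have q_inv := expi_mul_conj (2 * pi / N%:R : R).
have q_sum : 2 - expi (2 * pi / N%:R) - Num.conj (expi (2 * pi / N%:R))
    = (xi ^+ 2)%:C.
  by rewrite hxi -two_sub_expi (_ : pi / N%:R + pi / N%:R = 2 * pi / N%:R) //; ring.
(* A single commutator with [x2] exchanges [x4] and [x5] up to a scalar; its square respects [dag],
   so the eigenvalue relation on [U2] descends to both. *)
have [x2x4 x2x5] : dlie x2 x4 = (xi ^+ 2)%:C *: x4 /\ dlie x2 x5 = (xi ^+ 2)%:C *: x5.
  apply: (cartesian_eigen (dlieD x2) (dlieZ x2) _ (conjC_real _) hX45).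
    by move=> w; apply: dag_dlie.
  by rewrite (@dlie_eigen _ _ _ _ (- xi%:C)) ?sqrrN ?rmorphXn // lieC U2x2 scaleNr.
pose torus y y' w : A := dlie y w + dlie y' w.
have torusD y y' : {morph torus y y' : v w / v + w}.
  by move=> v w; rewrite /torus !dlieD addrACA.
have torusZ y y' c w : torus y y' (c *: w) = c *: torus y y' w.
  by rewrite /torus !dlieZ -scalerDr.
have torus_dag y y' w : dag y = y -> dag y' = y' ->
    dag (torus y y' w) = torus y y' (dag w).
  by move=> hy hy'; rewrite /torus dagD !(@dag_dlie _ _ _ _ hy, @dag_dlie _ _ _ _ hy').
have [t68 t69] : torus x6 x7 x8 = (xi ^+ 2)%:C *: x8 /\
    torus x6 x7 x9 = (xi ^+ 2)%:C *: x9.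
  apply: (cartesian_eigen (torusD x6 x7) (torusZ x6 x7) _ (conjC_real _) hX89).
    by move=> w; apply: torus_dag.
  by rewrite /torus (dlie_clock_shift uU hX67 q_inv UV) q_sum.
have [t86 t87] : torus x8 x9 x6 = (xi ^+ 2)%:C *: x6 /\
    torus x8 x9 x7 = (xi ^+ 2)%:C *: x7.
  apply: (cartesian_eigen (torusD x8 x9) (torusZ x8 x9) _ (conjC_real _) hX67).
    by move=> w; apply: torus_dag.
  (* Exchanging clock and shift replaces q by q^*, and 2 - q - q^* is symmetric in the two. *)
  have VU : V * U = Num.conj (expi (2 * pi / N%:R)) *: (U * V).
    by rewrite UV scalerA mulrC q_inv scale1r.
  rewrite /torus (dlie_clock_shift uV hX89 _ VU) conjCK -?q_sum 1?mulrC //.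
  by rewrite addrAC.
have dlie01 : dlie x0 x1 = 0.
  by apply: dlie_scalar; have := x01 0 1; rewrite lo0 lo1; apply.
have dlie10 : dlie x1 x0 = 0.
  by apply: dlie_scalar; have := x01 1 0; rewrite lo0 lo1; apply.
(* No cross terms arise: [x0], [x1], [x3] commute with [s] and act on [P] alone, the other matrices
   commute with [P] and act on [s] alone. The two contributions cancel by [kk]. *)
have boxP s : GRing.comm P s -> GRing.comm x0 s -> GRing.comm x1 s ->
    GRing.comm x3 s ->
    dlie x2 s + (dlie x4 s + dlie x6 s + (dlie x5 s + dlie x7 s)
                 + (dlie x8 s + dlie x9 s)) = (xi ^+ 2)%:C *: s ->
    box X' (s * P) = 0.
  move=> Ps s0 s1 s3 inner; rewrite boxE; last exact: commrM.
  rewrite !(dlieMr _ s0, dlieMr _ s1, dlieMr _ s3).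
  rewrite (dlie_eigen x0P) (dlie_eigen x1P) (dlie_eigen x3P).
  rewrite (dlieMl _ (commr_sym P2)) (dlieMl _ (commr_sym P4)).
  rewrite (dlieMl _ (commr_sym P5)) (dlieMl _ (commr_sym P6)).
  rewrite (dlieMl _ (commr_sym P7)) (dlieMl _ (commr_sym P8)).
  rewrite (dlieMl _ (commr_sym P9)) -!mulrDl.
  have regroup (a b c d e : A) : a + b + (c + d) + e = a + b + d + (c + e).
    by rewrite (addrC c d) !addrA.
  rewrite regroup -mulrDl inner.
  rewrite -!scalerAr -scalerAl -scaleNr -!scalerDl.
  rewrite sqrrN -!rmorphXn -rmorphN -!rmorphD.
  by rewrite kk rmorph0 scale0r.
have bP4 : box X' (x4 * P) = 0.
  apply: boxP => //; try exact: commr_sym.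
  rewrite x2x4 (dlie_comm (commr_refl x4)) (dlie_comm x64) (dlie_comm (commr_sym x45)).
  by rewrite (dlie_comm x74) (dlie_comm x84) (dlie_comm x94) !addr0.
have bP5 : box X' (x5 * P) = 0.
  apply: boxP => //; try exact: commr_sym.
  rewrite x2x5 (dlie_comm (commr_refl x5)) (dlie_comm x65) (dlie_comm x45).
  by rewrite (dlie_comm x75) (dlie_comm x85) (dlie_comm x95) !addr0.
have bP6 : box X' (x6 * P) = 0.
  apply: boxP => //; try exact: commr_sym.
  rewrite (dlie_comm (commr_sym x62)) (dlie_comm (commr_sym x64)).
  rewrite (dlie_comm (commr_sym x65)) (dlie_comm (commr_refl x6)).
  by rewrite (dlie_comm (commr_sym x67)) !add0r.
have bP7 : box X' (x7 * P) = 0.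
  apply: boxP => //; try exact: commr_sym.
  rewrite (dlie_comm (commr_sym x72)) (dlie_comm (commr_sym x74)).
  rewrite (dlie_comm (commr_sym x75)) (dlie_comm (commr_refl x7)).
  by rewrite (dlie_comm x67) !add0r.
have bP8 : box X' (x8 * P) = 0.
  apply: boxP => //; try exact: commr_sym.
  rewrite (dlie_comm (commr_sym x82)) (dlie_comm (commr_sym x84)).
  rewrite (dlie_comm (commr_sym x85)) (dlie_comm (commr_refl x8)).
  by rewrite (dlie_comm (commr_sym x89)) !add0r !addr0 -t68.
have bP9 : box X' (x9 * P) = 0.
  apply: boxP => //; try exact: commr_sym.
  rewrite (dlie_comm (commr_sym x92)) (dlie_comm (commr_sym x94)).
  rewrite (dlie_comm (commr_sym x95)) (dlie_comm (commr_refl x9)).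
  by rewrite (dlie_comm x89) !add0r !addr0 -t69.
have boxZP s t y y' : cartesian ((s + 'i *: t) * P) y y' ->
    box X' (s * P) = 0 -> box X' (t * P) = 0 -> box X' y = 0 /\ box X' y' = 0.
  move=> syy bs bt.
  have [] := @cartesian_eigen _ _ (box X') 0 _ _ _ (boxD X') (boxZ X') _ (conjC0 _) syy.
  - by move=> w; apply: dag_box.
  - by rewrite mulrDl boxD -scalerAl boxZ bs bt scaler0 addr0 scale0r.
  by rewrite !scale0r.
(* To be applied with [w] equal to [x0], [x1], [x3]. These do not commute with [P] in general, so
   the twist cannot be removed by [boxE]. *)
have skew (s t y y' w : A) (c : R) : cartesian (s + 'i *: t) s t ->
    cartesian ((s + 'i *: t) * P) y y' -> GRing.comm s t ->
    GRing.comm P s -> GRing.comm P t -> dag w = w ->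
    GRing.comm w s -> GRing.comm w t -> lie w P = c%:C *: P ->
    dlie y w + dlie y' w = 0.
  move=> st syy cst Ps Pt hw ws wt wP.
  apply: (dlie_cartesian_eigen syy hw (conjC_real c)).
    apply/(cartesian_normal syy); apply: (unitary_normalM (cartesian_comm st Ps Pt) uP).
    exact/(cartesian_normal st).
  by rewrite lieMr wP (lie_comm (cartesian_comm st ws wt)) mul0r add0r -scalerAr.
have [b4 b5] := boxZP _ _ _ _ hX'45 bP4 bP6.
have [b6 b7] := boxZP _ _ _ _ hX'67 bP5 bP7.
have [b8 b9] := boxZP _ _ _ _ hX'89 bP8 bP9.
move=> a; rewrite ikkt_sumE; move: a.
(* The equations for 4 to 9 are [b4] to [b9]; those for 0 to 3 remain. *)
apply: ord10_ind; rewrite ?x'0 ?x'1 ?x'2 ?x'3 //.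
- rewrite /box x'0 x'1 x'2 x'3.
  rewrite (skew _ _ _ _ _ _ hZ1 hX'45 _ P4 P6 hx0 _ _ x0P) //; try exact: commr_sym.
  rewrite (skew _ _ _ _ _ _ hZ2 hX'67 _ P5 P7 hx0 _ _ x0P) //; try exact: commr_sym.
  rewrite (skew _ _ _ _ _ _ hZ3 hX'89 _ P8 P9 hx0 _ _ x0P) //; try exact: commr_sym.
  rewrite (dlie_comm (commr_refl x0)) (dlie_comm x20) (dlie_comm x30).
  by rewrite dlie10 oppr0 !addr0.
- rewrite /box x'0 x'1 x'2 x'3.
  rewrite (skew _ _ _ _ _ _ hZ1 hX'45 _ P4 P6 hx1 _ _ x1P) //; try exact: commr_sym.
  rewrite (skew _ _ _ _ _ _ hZ2 hX'67 _ P5 P7 hx1 _ _ x1P) //; try exact: commr_sym.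
  rewrite (skew _ _ _ _ _ _ hZ3 hX'89 _ P8 P9 hx1 _ _ x1P) //; try exact: commr_sym.
  rewrite (dlie_comm (commr_refl x1)) (dlie_comm x21) (dlie_comm x31).
  by rewrite dlie01 oppr0 !addr0.
(* As [x2] commutes with [P], the twist is removed first; then only [x4] and [x5] fail to drop out
   at once, and they are the parts of the normal matrix [U2]. *)
- rewrite boxE // (dlie_comm (commr_sym x20)) (dlie_comm (commr_sym x21)).
  rewrite (dlie_comm (commr_refl x2)) (dlie_comm (commr_sym x23)).
  rewrite (dlie_comm x62) (dlie_comm x72) (dlie_comm x82) (dlie_comm x92).
  rewrite oppr0 !addr0 !add0r.
  apply: (dlie_cartesian_eigen hX45 hx2 (conjC_real (- xi)) x45).
  by rewrite lieC U2x2 -scaleNr -rmorphN.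
- rewrite /box x'0 x'1 x'2 x'3.
  have x3P' : lie x3 P = (- xi3)%:C *: P by rewrite rmorphN x3P.
  rewrite (skew _ _ _ _ _ _ hZ1 hX'45 _ P4 P6 hx3 _ _ x3P') //; try exact: commr_sym.
  rewrite (skew _ _ _ _ _ _ hZ2 hX'67 _ P5 P7 hx3 _ _ x3P') //; try exact: commr_sym.
  rewrite (skew _ _ _ _ _ _ hZ3 hX'89 _ P8 P9 hx3 _ _ x3P') //; try exact: commr_sym.
  rewrite (dlie_comm (commr_refl x3)) (dlie_comm (commr_sym x30)).
  by rewrite (dlie_comm (commr_sym x31)) (dlie_comm x23) oppr0 !addr0.
Qed.
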